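(* Let $\gamma>0$ be a given disturbance attenuation level. Consider the time-invariant system $x_{k+1}=f(x_k,w_k,v_k)$, $y_k=g(x_k,v_k)$, $z_k=m(x_k,v_k)$ and the filter $\hat x_{k+1}=\hat f(\hat x_k)+\hat g(y_k)$, $\hat z_k=\hat m(\hat x_k)$, with augmented system $\eta_{k+1}=\tilde f(\eta_k,w_k,v_k)$, $\tilde z_k=\tilde m(\eta_k,v_k)$ as described in the context. Suppose there exist a positive radially unbounded Lyapunov function $V:\mathcal R^{n_\eta}\to[0,\infty)$ and a positive radially unbounded function $W:\mathcal R^{n_\eta}\to[0,\infty)$ such that $$E[V(\tilde f(\eta,w_k,v))]-V(\eta)+\|\tilde m(\eta,v)\|^2-\gamma^2\|v\|^2\le0\quad\text{for all }\eta\in\mathcal R^{n_\eta},\ v\in\mathcal R^{n_v},\ k\in\mathcal N,$$ and $$\|\tilde m(\eta,0)\|^2\ge W(\eta)\quad\text{for all }\eta\in\mathcal R^{n_\eta}.$$ Then the filter is a desired $H_\infty$ filter for the system, i.e. the augmented system is both internally stable and externally stable (with level $\gamma$).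
   Context: $\mathcal N=\{0,1,2,\dots\}$. $\{w_k\}_{k\in\mathcal N}$ is a sequence of independent $\mathcal R^{n_w}$-valued random variables on a complete probability space $(\Omega,\mathcal F,\mathcal P)$, $\mathcal F_0=\{\emptyset,\Omega\}$, $\mathcal F_k=\sigma(w_0,\dots,w_{k-1})$. $l^2_\infty(\Omega,\mathcal F,\{\mathcal F_k\},\mathcal R^{n_v})$ is the space of $\mathcal F_k$-adapted sequences $v=\{v_k\}$ with $\|v\|^2_{l^2_\infty}=E\sum_{k\ge0}\|v_k\|^2<\infty$. System: $x_k\in\mathcal R^n$, $y_k\in\mathcal R^{n_y}$, $z_k\in\mathcal R^{n_z}$, disturbance $v_k\in\mathcal R^{n_v}$; $f,g,m$ are continuous with $f(0,0,0)=0$, $g(0,0)=0$, $m(0,0)=0$. Filter: $\hat x_k\in\mathcal R^{n_{\hat x}}$, $\hat x_0=0$, with (Borel measurable) maps satisfying $\hat f(0)=\hat g(0)=0$, $\hat m(0)=0$. Augmented system: $\eta_k=\begin{bmatrix}x_k\\ \hat x_k\end{bmatrix}\in\mathcal R^{n_\eta}$, $\tilde z_k=z_k-\hat z_k$, and for $\eta=\begin{bmatrix}x\\ \hat x\end{bmatrix}$, $\tilde f(\eta,w,v)=\begin{bmatrix}f(x,w,v)\\ \hat f(\hat x)+\hat g(g(x,v))\end{bmatrix}$, $\tilde m(\eta,v)=m(x,v)-\hat m(\hat x)$. A positive radially unbounded function $U$ on $\mathcal R^{n_\eta}$: continuous, $U(0)=0$, $U(\eta)>0$ for $\eta\ne0$,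 $\liminf_{\|\eta\|\to\infty}U(\eta)=\infty$. Internally stable: with $v\equiv0$, the solution $\eta_k^{0,\eta_0,0}$ of $\eta_{k+1}=\tilde f(\eta_k,w_k,0)$ starting at time $0$ from deterministic $\eta_0\in\mathcal R^{n_\eta}$ satisfies: for every $\varepsilon>0$, $\lim_{\eta_0\to0}\mathcal P(\sup_{k\ge0}\|\eta_k^{0,\eta_0,0}\|>\varepsilon)=0$; and $\mathcal P(\lim_{k\to\infty}\eta_k^{0,\eta_0,0}=0)=1$ for every $\eta_0$. Externally stable (level $\gamma$): for every nonzero $v\in l^2_\infty(\Omega,\mathcal F,\{\mathcal F_k\},\mathcal R^{n_v})$ and $\eta_0=0$, $\|\tilde z\|^2_{l^2_\infty}\le\gamma^2\|v\|^2_{l^2_\infty}$. *)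

(* Defs.v *)
From HB Require Import structures.
From mathcomp Require Import all_boot all_order all_algebra finmap.
From mathcomp Require Import all_classical all_reals all_analysis.

Set Implicit Arguments.
Unset Strict Implicit.
Unset Printing Implicit Defensive.

Import Order.TTheory GRing.Theory Num.Theory.
Import numFieldNormedType.Exports.

Local Open Scope classical_set_scope.
Local Open Scope ring_scope.

(* The norm of the library on matrices is the sup norm; the inequalities below
   involve the Euclidean one. Both induce the library topology on columns. *)
Definition enorm (R : realType) (n : nat) (x : 'cV[R]_n) : R :=
  Num.sqrt (\sum_(i < n) x i 0 ^+ 2).

Notation borel_cV R n := (g_sigma_algebraType (@open 'cV[R]_n)).

Definition borel_measurable (R : realType) (n m : nat)
    (h : 'cV[R]_n -> 'cV[R]_m) : Prop :=
  @measurable_fun _ _ (borel_cV R n) (borel_cV R m) setT h.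

Definition random_vector d (T : measurableType d) (R : realType) (n : nat)
    (X : T -> 'cV[R]_n) : Prop :=
  @measurable_fun _ _ T (borel_cV R n) setT X.

Definition independent_vectors d (T : measurableType d) (R : realType)
    (P : probability T R) (n : nat) (X : nat -> T -> 'cV[R]_n) : Prop :=
  forall (J : {fset nat}) (B : nat -> set (borel_cV R n)),
    (forall j, measurable (B j)) ->
    P (\bigcap_(j in [set` J]) (X j @^-1` B j)) =
      (\prod_(j <- J) P (X j @^-1` B j))%E.

(* F_k = sigma(w_0, ..., w_{k-1}); in particular F_0 = {set0, setT}. *)
Definition noise_filtration (T : Type) (R : realType) (n : nat)
    (w : nat -> T -> 'cV[R]_n) (k : nat) : set (set T) :=
  <<s \bigcup_(i in `I_k)
        preimage_set_system setT (w i) (@measurable _ (borel_cV R n)) >>.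

Definition adapted (T : Type) (R : realType) (n : nat)
    (F : nat -> set (set T)) (v : nat -> T -> 'cV[R]_n) : Prop :=
  forall k (B : set (borel_cV R n)), measurable B -> F k (v k @^-1` B).

Definition l2_norm_sq d (T : measurableType d) (R : realType)
    (P : probability T R) (n : nat) (v : nat -> T -> 'cV[R]_n) : \bar R :=
  (\int[P]_t (\sum_(0 <= k <oo) (enorm (v k t) ^+ 2)%:E))%E.

Definition in_l2 d (T : measurableType d) (R : realType)
    (P : probability T R) (F : nat -> set (set T)) (n : nat)
    (v : nat -> T -> 'cV[R]_n) : Prop :=
  adapted F v /\ (l2_norm_sq P v < +oo)%E.

(* Elements of l^2 are identified when they agree almost surely. *)
Definition l2_zero d (T : measurableType d) (R : realType)
    (P : probability T R) (n : nat) (v : nat -> T -> 'cV[R]_n) : Prop :=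
  {ae P, forall t, forall k, v k t = 0}.

Definition norm_pinfty (R : realType) (n : nat) : set (set 'cV[R]_n) :=
  filter_from setT (fun r : R => [set x | r < enorm x]).

Definition positive_radially_unbounded (R : realType) (n : nat)
    (U : 'cV[R]_n -> R) : Prop :=
  [/\ continuous U, U 0 = 0, forall x, x != 0 -> 0 < U x &
      limf_einf (EFin \o U) (@norm_pinfty R n) = +oo%E].

Definition aug_dynamics (R : realType) (n nw nv ny nh : nat)
    (f : 'cV[R]_n * 'cV[R]_nw * 'cV[R]_nv -> 'cV[R]_n)
    (g : 'cV[R]_n * 'cV[R]_nv -> 'cV[R]_ny)
    (fh : 'cV[R]_nh -> 'cV[R]_nh) (gh : 'cV[R]_ny -> 'cV[R]_nh)
    (eta : 'cV[R]_(n + nh)) (w : 'cV[R]_nw) (v : 'cV[R]_nv) :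
    'cV[R]_(n + nh) :=
  col_mx (f (usubmx eta, w, v))
         (fh (dsubmx eta) + gh (g (usubmx eta, v))).

Definition aug_output (R : realType) (n nv nz nh : nat)
    (m : 'cV[R]_n * 'cV[R]_nv -> 'cV[R]_nz) (mh : 'cV[R]_nh -> 'cV[R]_nz)
    (eta : 'cV[R]_(n + nh)) (v : 'cV[R]_nv) : 'cV[R]_nz :=
  m (usubmx eta, v) - mh (dsubmx eta).

Fixpoint trajectory (T : Type) (R : realType) (N nw nv : nat)
    (F : 'cV[R]_N -> 'cV[R]_nw -> 'cV[R]_nv -> 'cV[R]_N)
    (w : nat -> T -> 'cV[R]_nw) (v : nat -> T -> 'cV[R]_nv)
    (eta0 : 'cV[R]_N) (k : nat) (t : T) : 'cV[R]_N :=
  if k is j.+1 then F (trajectory F w v eta0 j t) (w j t) (v j t) else eta0.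

Definition internally_stable d (T : measurableType d) (R : realType)
    (P : probability T R) (N nw nv : nat)
    (F : 'cV[R]_N -> 'cV[R]_nw -> 'cV[R]_nv -> 'cV[R]_N)
    (w : nat -> T -> 'cV[R]_nw) : Prop :=
  let eta (eta0 : 'cV[R]_N) := trajectory F w (fun _ _ => 0) eta0 in
  (forall eps : R, 0 < eps ->
     P [set t | (eps%:E <
                  ereal_sup (range (fun k => (enorm (eta eta0 k t))%:E)))%E]
       @[eta0 --> (0 : 'cV[R]_N)^'] --> 0%E) /\
  (forall eta0 : 'cV[R]_N,
     P [set t | eta eta0 k t @[k --> \oo] --> (0 : 'cV[R]_N)] = 1%E).

Definition externally_stable d (T : measurableType d) (R : realType)
    (P : probability T R) (N nw nv nz : nat)
    (F : 'cV[R]_N -> 'cV[R]_nw -> 'cV[R]_nv -> 'cV[R]_N)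
    (M : 'cV[R]_N -> 'cV[R]_nv -> 'cV[R]_nz)
    (w : nat -> T -> 'cV[R]_nw) (gamma : R) : Prop :=
  forall v : nat -> T -> 'cV[R]_nv,
    in_l2 P (noise_filtration w) v -> ~ l2_zero P v ->
    (l2_norm_sq P (fun k t => M (trajectory F w v 0 k t) (v k t)) <=
       (gamma ^+ 2)%:E * l2_norm_sq P v)%E.

Definition Hinfty_filter d (T : measurableType d) (R : realType)
    (P : probability T R) (n nw nv ny nz nh : nat)
    (w : nat -> T -> 'cV[R]_nw)
    (f : 'cV[R]_n * 'cV[R]_nw * 'cV[R]_nv -> 'cV[R]_n)
    (g : 'cV[R]_n * 'cV[R]_nv -> 'cV[R]_ny)
    (m : 'cV[R]_n * 'cV[R]_nv -> 'cV[R]_nz)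
    (fh : 'cV[R]_nh -> 'cV[R]_nh) (gh : 'cV[R]_ny -> 'cV[R]_nh)
    (mh : 'cV[R]_nh -> 'cV[R]_nz) (gamma : R) : Prop :=
  internally_stable P (aug_dynamics f g fh gh) w /\
  externally_stable P (aug_dynamics f g fh gh) (aug_output m mh) w gamma.

(* Main.v *)
(* Since eta_k and v_k are functions of w_0, ..., w_{k-1}, independence of w_k and
   Tonelli turn the pointwise dissipation inequality into
     E V(eta_{k+1}) + E |z_k|^2 <= E V(eta_k) + gamma^2 E |v_k|^2,
   and summing over k with V(0) = 0 gives external stability. For v = 0 it makes
   V(eta_k) a nonnegative supermartingale: the maximal inequality
   P(sup_k V(eta_k) >= c) <= V(eta_0) / c yields stability in probability, and
   sum_k E W(eta_k) <= V(eta_0) < oo forces W(eta_k), hence eta_k, to tend to 0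
   almost surely. *)
Require Import Defs.
From HB Require Import structures.
From mathcomp Require Import all_boot all_order all_algebra finmap.
From mathcomp Require Import all_classical all_reals all_analysis.
From mathcomp Require Import measurable_realfun.

Set Implicit Arguments.
Unset Strict Implicit.
Unset Printing Implicit Defensive.

Import Order.TTheory GRing.Theory Num.Theory.
Import numFieldNormedType.Exports.

Local Open Scope classical_set_scope.
Local Open Scope ring_scope.

(** Conditioning on the past is replaced by an integral over a second copy of the sample space: the
    state and the disturbance at time k are held fixed and only [w k] is integrated. This needs
    joint measurability for product sigma-algebras, whereas [f], [g], [m] are continuous for product
    topologies; second countability of the matrix spaces reconciles the two. The filter maps being
    only Borel, measurability is all that the augmented dynamics retains. No integrability of V
    along the trajectory is known beforehand, so dissipation is kept as a comparison of sums of
    nonnegative extended reals, never of differences. Bounds on [V] and [W] become bounds on the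
    state because each function has a positive lower bound outside any ball about 0. *)

Notation borel A := (g_sigma_algebraType (@open A)).

(** * Borel measurability and second countable spaces *)

Definition countably_based (A : topologicalType) :=
  exists (I : countType) (B : I -> set A), (forall i, open (B i)) /\
    forall x U, nbhs x U -> exists i, B i x /\ B i `<=` U.

Lemma countably_based_prod (A B : topologicalType) :
  countably_based A -> countably_based B -> countably_based (A * B)%type.
Proof.
move=> [I [F [oF bF]]] [J [G [oG bG]]].
exists (I * J)%type, (fun ij => F ij.1 `*` G ij.2); split.
  move=> [i j] /=; rewrite openE => -[x y] /= [Fx Gy].
  by exists (F i, G j) => //=; split; apply: open_nbhs_nbhs.
move=> [x y] U [[U1 U2] /= [nU1 nU2] sU].
have [i [Fix sFi]] := bF _ _ nU1; have [j [Gjy sGj]] := bG _ _ nU2.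
exists (i, j); split => //= -[a b] /= [Fa Gb]; apply: sU; split => /=.
  exact: sFi.
exact: sGj.
Qed.

Lemma countably_based_matrix (R : realType) (m n : nat) :
  countably_based 'M[R]_(m, n).
Proof.
exists ('M[rat]_(m, n) * nat)%type,
  (fun qk => ball (map_mx ratr qk.1 : 'M[R]_(m, n)) (qk.2.+1%:R^-1 : R)).
split=> [[q k] /=|x U].
  exact: ball_open.
move=> /nbhs_ballP[e /= e0 sU].
(* Half of [e]: a ball of radius 1/(k+1) whose centre is that close to [x] then stays within [e] of
   [x]. *)
have [k /= ke] : exists k, k.+1%:R^-1 < e / 2 :> R.
  have e20 : 0 < e / 2 by rewrite divr_gt0.
  exists (Num.truncn (e / 2)^-1).
  by rewrite invf_plt ?posrE// truncnS_gt.
have k0 : 0 < k.+1%:R^-1 :> R by rewrite invr_gt0 ltr0n.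
have hq i j : exists r : rat, ball (x i j) (k.+1%:R^-1 : R) (ratr r : R).
  have [//|r] := @rat_in_itvoo R (x i j - k.+1%:R^-1) (x i j + k.+1%:R^-1).
    by rewrite ltrD2l gt0_cp.
  rewrite in_itv /= => /andP[r1 r2]; exists r.
  by rewrite /ball/= ltr_distlC r1 r2.
have [q xq] : exists q : 'M[rat]_(m, n),
    ball x (k.+1%:R^-1 : R) (map_mx ratr q : 'M[R]_(m, n)).
  exists (\matrix_(i, j) xchoose (hq i j)).
  by split => // i j; rewrite !mxE; exact: (xchooseP (hq i j)).
exists (q, k); split => /=; first exact: ball_sym.
move=> y qy; apply: sU; rewrite [e]splitr.
by apply: ball_triangle (le_ball (ltW ke) xq) (le_ball (ltW ke) qy).
Qed.

(** Borel measurability expressed without a measurable structure on [A]: when [A] is a product, it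
    refers to the product topology and not to the product sigma-algebra. *)
Definition open_preimage_measurable d (T : measurableType d) (A : topologicalType)
    (X : T -> A) := forall S : set A, open S -> measurable (X @^-1` S).

Lemma measurable_fun_borelP d (T : measurableType d) (A : ptopologicalType) (X : T -> A) :
  @measurable_fun _ _ T (borel A) setT X <-> open_preimage_measurable X.
Proof.
split=> [mX S oS|mX].
  have mS : @measurable _ (borel A) S by exact: sub_sigma_algebra.
  by have := mX measurableT _ mS; rewrite setTI.
apply: (@measurability _ _ T (borel A) _ _ open) => //.
by move=> _ [S oS <-]; rewrite setTI; exact: mX.
Qed.

Lemma open_preimage_measurable_comp d (T : measurableType d) (A B : topologicalType)
    (h : A -> B) (X : T -> A) :
  continuous h -> open_preimage_measurable X -> open_preimage_measurable (h \o X).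
Proof. by move=> /continuousP ch mX S oS; exact: (mX _ (ch _ oS)). Qed.

(** An open set of the product is the union of the basic rectangles that it contains, and there are
    only countably many of them. *)
Lemma open_preimage_measurable_pair d (T : measurableType d) (A B : topologicalType)
    (X : T -> A) (Y : T -> B) :
  countably_based A -> countably_based B ->
  open_preimage_measurable X -> open_preimage_measurable Y ->
  open_preimage_measurable (fun t => (X t, Y t)).
Proof.
move=> [I [F [oF bF]]] [J [G [oG bG]]] mX mY S oS.
(* The first factor does not depend on [t]: it is everything or empty, and so discards the
   rectangles that leave [S]. *)
pose Q (ij : I * J) := [set t | F ij.1 `*` G ij.2 `<=` S] `&`
  (X @^-1` F ij.1 `&` Y @^-1` G ij.2).
rewrite [X in measurable X](_ : _ = \bigcup_ij Q ij); last first.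
  apply/seteqP; split => [t /= St|t [ij _ [/= sO [? ?]]]]; last exact: (sO (_, _)).
  have := oS; rewrite openE => /(_ _ St) [[U1 U2] /= [nU1 nU2] sU].
  have [i [Fix sFi]] := bF _ _ nU1; have [j [Gjy sGj]] := bG _ _ nU2.
  exists (i, j) => //; split => //= -[a b] /= [Fa Gb]; apply: sU; split => /=.
    exact: sFi.
  exact: sGj.
apply: countable_bigcupT_measurable; first exact: countableP.
move=> [i j]; rewrite /Q /=.
have [sO|nsO] := pselect (F i `*` G j `<=` S); last first.
  by rewrite (_ : [set _ | _] = set0) ?set0I// -subset0 => t.
rewrite (_ : [set _ | _] = setT) ?setTI; last by apply/seteqP; split.
by apply: measurableI; [exact: mX|exact: mY].
Qed.

Lemma measurable_continuous_pair d (T : measurableType d) (A B C : ptopologicalType)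
    (h : A * B -> C) (X : T -> A) (Y : T -> B) :
  countably_based A -> countably_based B -> continuous h ->
  @measurable_fun _ _ T (borel A) setT X ->
  @measurable_fun _ _ T (borel B) setT Y ->
  @measurable_fun _ _ T (borel C) setT (fun t => h (X t, Y t)).
Proof.
move=> cA cB ch /measurable_fun_borelP mX /measurable_fun_borelP mY.
apply/measurable_fun_borelP; apply: (open_preimage_measurable_comp ch).
exact: open_preimage_measurable_pair.
Qed.

Lemma continuous_measurable_borel (A B : ptopologicalType) (h : A -> B) :
  continuous h -> @measurable_fun _ _ (borel A) (borel B) setT h.
Proof.
move=> /continuousP ch; apply/measurable_fun_borelP => S oS.
by apply: sub_sigma_algebra; exact: ch.
Qed.

Lemma continuous_measurable_realfun (R : realType) (A : ptopologicalType) (h : A -> R) :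
  continuous h -> @measurable_fun _ _ (borel A) R setT h.
Proof.
move=> /continuousP ch; apply: (measurability _ (RGenOpens.measurableE R)).
move=> _ [_ [a [b ->] <-]]; rewrite setTI; apply: sub_sigma_algebra.
exact/ch/interval_open.
Qed.

(** * Matrix blocks and the Euclidean norm: continuity and compactness *)

Lemma cvg_matrix (T : Type) (F : set_system T) (FF : Filter F) (R : realType) (m n : nat)
    (h : T -> 'M[R]_(m, n)) (M : 'M[R]_(m, n)) :
  (forall i j, h x i j @[x --> F] --> M i j) -> h @ F --> M.
Proof.
move=> hM U [P nP sU].
suff : F [set x | forall i j, P i j (h x i j)].
  by apply: (@filterS _ F FF _ (h @^-1` U)) => x; exact: sU.
by apply: filter_forall => i; apply: filter_forall => j; exact: hM.
Qed.

Lemma continuous_matrix (T : topologicalType) (R : realType) (m n : nat)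
    (h : T -> 'M[R]_(m, n)) :
  (forall i j, continuous (fun x => h x i j)) -> continuous h.
Proof. by move=> ch x; apply: cvg_matrix => i j; exact: ch. Qed.

Lemma usubmx_continuous (R : realType) (m1 m2 n : nat) :
  continuous (@usubmx R m1 m2 n).
Proof.
apply: continuous_matrix => i j.
under eq_fun do rewrite mxE; exact: coord_continuous.
Qed.

Lemma dsubmx_continuous (R : realType) (m1 m2 n : nat) :
  continuous (@dsubmx R m1 m2 n).
Proof.
apply: continuous_matrix => i j.
under eq_fun do rewrite mxE; exact: coord_continuous.
Qed.

Lemma col_mx_continuous (R : realType) (m1 m2 n : nat) :
  continuous (fun p : 'M[R]_(m1, n) * 'M[R]_(m2, n) => col_mx p.1 p.2).
Proof.
apply: continuous_matrix => i j; case: (split_ordP i) => k ->.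
  under eq_fun do rewrite col_mxEu.
  move=> p.
  apply: (@continuous_comp _ _ _ fst (fun M : 'M[R]_(m1, n) => M k j)).
    exact: cvg_fst.
  exact: coord_continuous.
under eq_fun do rewrite col_mxEd.
move=> p.
apply: (@continuous_comp _ _ _ snd (fun M : 'M[R]_(m2, n) => M k j)).
  exact: cvg_snd.
exact: coord_continuous.
Qed.

Lemma enorm_continuous (R : realType) (n : nat) : continuous (@enorm R n).
Proof.
move=> x; apply: (@continuous_comp _ _ _ _ Num.sqrt); last exact: sqrt_continuous.
apply: (@cvg_big R _ +%R 0 _ _ _ (nbhs x)); first exact: add_continuous.
move=> i _; apply: (@continuous_comp _ _ _ (fun y : 'cV[R]_n => y i 0) (fun r => r ^+ 2)).
  exact: coord_continuous.
exact: exprn_continuous.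
Qed.

Lemma enorm_ge0 (R : realType) (n : nat) (x : 'cV[R]_n) : 0 <= enorm x.
Proof. exact: sqrtr_ge0. Qed.

Lemma enorm0 (R : realType) (n : nat) : enorm (0 : 'cV[R]_n) = 0.
Proof.
by rewrite /enorm big1 ?sqrtr0// => i _; rewrite mxE expr0n.
Qed.

Lemma coord_le_enorm (R : realType) (n : nat) (x : 'cV[R]_n) i : `|x i 0| <= enorm x.
Proof.
rewrite -sqrtr_sqr ler_wsqrtr// (bigD1 i)//= lerDl sumr_ge0// => j _.
exact: sqr_ge0.
Qed.

Lemma cvg_enorm0 (T : Type) (F : set_system T) (FF : Filter F) (R : realType) (n : nat)
    (h : T -> 'cV[R]_n) :
  enorm (h x) @[x --> F] --> 0 -> h @ F --> (0 : 'cV[R]_n).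
Proof.
move=> h0; apply: cvg_matrix => i j; rewrite mxE (ord1 j); apply/norm_cvg0P.
apply: (squeeze_cvgr _ (cvg_cst 0) h0).
by near=> x; rewrite normr_ge0 coord_le_enorm.
Unshelve. all: by end_near. Qed.

(** Heine-Borel is applied to row vectors, whose sup norm is dominated by the Euclidean one, and the
    result is carried to columns by transposition. *)
Lemma compact_enorm_le (R : realType) (n : nat) (r : R) :
  compact [set x : 'cV[R]_n | enorm x <= r].
Proof.
have cV : compact [set v : 'rV[R]_n | enorm v^T <= r].
  apply: bounded_closed_compact.
    exists r; split; [exact: num_real|move=> M rM v /= vr].
    rewrite [leLHS]/Num.Def.normr/= mx_normrE; apply: bigmax_le.
      by rewrite (le_trans _ (ltW rM))// (le_trans _ vr)// enorm_ge0.
    move=> [i j] _ /=; rewrite (ord1 i) (le_trans _ (ltW rM))// (le_trans _ vr)//.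
    by have := coord_le_enorm v^T j; rewrite mxE.
  rewrite [X in closed X](_ : _ = (fun v : 'rV[R]_n => enorm v^T) @^-1` [set x | x <= r])//.
  apply: closed_comp; last exact: closed_le.
  move=> v _; apply: (@continuous_comp _ _ _ trmx (@enorm R n)); last exact: enorm_continuous.
  apply: continuous_matrix => i j; under eq_fun do rewrite mxE.
  exact: coord_continuous.
rewrite [X in compact X](_ : _ = trmx @` [set v : 'rV[R]_n | enorm v^T <= r]); last first.
  by apply/seteqP; split => [x xr|_ [v vr <-]//]; exists x^T; rewrite /= ?trmxK.
apply: continuous_compact cV; apply: continuous_subspaceT.
apply: continuous_matrix => i j; under eq_fun do rewrite mxE.
exact: coord_continuous.
Qed.

(* The infimum of U over the annulus eps <= |x| <= r is attained, while
   radial unboundedness makes U at least 1 beyond some radius r. *)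
Lemma positive_radially_unbounded_lower_bound (R : realType) (n : nat) (U : 'cV[R]_n -> R)
    (eps : R) :
  positive_radially_unbounded U -> 0 < eps ->
  exists2 c, 0 < c & forall x, eps <= enorm x -> c <= U x.
Proof.
move=> [cU U0 Upos Uoo] e0.
have [r far] : exists r, forall x, r < enorm x -> 1 <= U x.
  have : (1%:E < limf_einf (EFin \o U) (@norm_pinfty R n))%E by rewrite Uoo ltry.
  rewrite limf_einfE => /ereal_sup_gt[_ [A [r _ sA] <-] lA].
  exists r => x xr; rewrite -lee_fin; apply/ltW/(lt_le_trans lA).
  by apply: ereal_inf_lbound; exists x => //; exact: sA.
pose K := [set x : 'cV[R]_n | enorm x <= r] `&` [set x | eps <= enorm x].
have cK : compact K.
  apply: compact_closedI; first exact: compact_enorm_le.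
  rewrite [X in closed X](_ : _ = @enorm R n @^-1` [set x | eps <= x])//.
  by apply: closed_comp; [move=> x _; exact: enorm_continuous|exact: closed_ge].
have [/eqP K0|/set0P K0] := boolP (K == set0).
  exists 1 => // x ex; have [xr|xr] := leP (enorm x) r; last exact: far.
  by have : K x by []; rewrite K0.
have [x0 Kx0 minx0] : exists2 x, K x & forall y, K y -> U x <= U y.
  have [x] := compact_EVT_min K0 cK (continuous_subspaceT cU).
  by rewrite inE => Kx minx; exists x => // y Ky; apply: minx; rewrite inE.
have Ux0 : 0 < U x0.
  apply: Upos; apply: contraTneq (lt_le_trans e0 Kx0.2) => ->.
  by rewrite enorm0 ltxx.
exists (Num.min 1 (U x0)); first by rewrite lt_min ltr01 Ux0.
move=> x ex; rewrite ge_min; have [xr|xr] := leP (enorm x) r.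
  by rewrite minx0 ?orbT.
by rewrite far.
Qed.

(** * Independence of the noise from its past *)

Section past_of_noise.
Context d (T : measurableType d) (R : realType) (P : probability T R) (nw : nat).
Variable w : nat -> T -> 'cV[R]_nw.
Hypothesis hw : forall k, random_vector (w k).

(** The sample space equipped with F_k, so that being adapted becomes ordinary measurability and the
    closure properties of measurable maps apply to it. *)
Definition noise_space k : Type := g_sigma_algebraType (\bigcup_(i in `I_k)
  preimage_set_system setT (w i) (@measurable _ (borel_cV R nw))).
HB.instance Definition _ k := Measurable.on (noise_space k).

Lemma noise_filtration_measurable k : noise_filtration w k `<=` @measurable _ T.
Proof.
apply: smallest_sub; first exact: sigma_algebra_measurable.
by move=> _ [i _ [B mB <-]]; exact: hw.
Qed.

Lemma noise_filtration_mono k l : (k <= l)%N ->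
  noise_filtration w k `<=` noise_filtration w l.
Proof.
move=> kl; apply: sub_smallest2r; first exact: smallest_sigma_algebra.
move=> A [i /= ik ?]; exists i => //=.
exact: leq_trans ik kl.
Qed.

(** A pi-system generating F_k. Every [w i] with i < k is constrained, a free coordinate being given
    the full set. *)
Definition noise_cylinders k : set (set T) :=
  [set \bigcap_(i in `I_k) (w i @^-1` B i) |
     B in [set B : nat -> set (borel_cV R nw) | forall i, measurable (B i)]].

Lemma setI_closed_noise_cylinders k : setI_closed (noise_cylinders k).
Proof.
move=> _ _ [B mB <-] [C mC <-]; exists (fun i => B i `&` C i).
  by move=> i /=; exact: measurableI.
by rewrite -bigcapI.
Qed.

Lemma noise_filtration_cylinders k :
  noise_filtration w k `<=` <<s noise_cylinders k >>.
Proof.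
apply: sub_smallest2r; first exact: smallest_sigma_algebra.
move=> _ [i /= ik [B mB <-]]; exists (fun j => if j == i then B else setT).
  by move=> j /=; case: ifP.
apply/seteqP; split => [t /= /(_ i ik)|t /= [_ Bt] j jk]; first by rewrite eqxx.
by rewrite /preimage /=; case: eqP => // ->.
Qed.

Lemma measurable_noise_cylinder k (B : nat -> set (borel_cV R nw)) :
  (forall i, measurable (B i)) -> measurable (\bigcap_(i in `I_k) (w i @^-1` B i)).
Proof.
move=> mB; apply: bigcap_measurableType => i _.
by rewrite -[X in measurable X]setTI; exact: hw.
Qed.

Hypothesis hindep : independent_vectors P w.

Lemma noise_cylinder_prod k (B : nat -> set (borel_cV R nw)) :
  (forall i, measurable (B i)) ->
  P (\bigcap_(i in `I_k) (w i @^-1` B i)) = (\prod_(i < k) P (w i @^-1` B i))%E.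
Proof.
move=> mB; have := hindep [fset i in iota 0 k]%fset mB.
rewrite (_ : [set` _] = `I_k); last first.
  by apply/seteqP; split => i /=; rewrite !inE /= mem_iota.
move=> ->; rewrite -(big_mkord xpredT (fun i => P (w i @^-1` B i))).
rewrite /index_iota subn0; apply: perm_big.
apply: uniq_perm; rewrite ?fset_uniq ?iota_uniq// => i.
by rewrite inE.
Qed.

Lemma noise_independent_past k (A : set T) (B : set (borel_cV R nw)) :
  noise_filtration w k A -> measurable B ->
  P (A `&` w k @^-1` B) = (P A * P (w k @^-1` B))%E.
Proof.
move=> FA mB; set C := w k @^-1` B.
have mC : measurable C by rewrite -[C]setTI; exact: hw.
suff : <<s noise_cylinders k >> `<=`
    [set A | measurable A /\ P (A `&` C) = (P A * P C)%E].
  by move=> /(_ _ (noise_filtration_cylinders FA))[].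
apply: lambda_system_subset => //.
- exact: setI_closed_noise_cylinders.
- apply/dynkin_lambda_system; split.
  + by split => //; rewrite setTI probability_setT mul1e.
  + move=> D [mD PD]; split; first exact: measurableC.
    rewrite setIC -setDE measureD//; last by rewrite ltey_eq fin_num_measure.
    rewrite [X in (_ - P X)%E]setIC PD probability_setC// muleBl ?fin_num_measure//.
    by rewrite mul1e.
  + move=> D tD mD; split; first by apply: bigcupT_measurable => n; exact: (mD n).1.
    rewrite setI_bigcupl measure_bigcup//; last first.
    * exact: (@trivIset_setIr _ _ _ _ (fun=> C)).
    * by move=> n _; apply: measurableI => //; exact: (mD n).1.
    rewrite measure_bigcup//; last by move=> n _; exact: (mD n).1.
    transitivity (\sum_(0 <= n <oo | n \in setT) (P C * P (D n)))%E.
      by apply: eq_eseriesr => n _; rewrite muleC; exact: (mD n).2.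
    rewrite [RHS]muleC -{2}(fineK (fin_num_measure P C mC)) -nneseriesZl//.
    by rewrite fineK// fin_num_measure.
- move=> _ [D mD <-]; split; first exact: measurable_noise_cylinder.
  (* Placing [B] at index [k] makes the intersection a cylinder over k+1 coordinates, whose product
     formula has exactly one more factor. *)
  pose D' i := if i == k then B else D i.
  have mD' i : measurable (D' i) by rewrite /D'; case: ifP.
  have D'k : D' k = B by rewrite /D' eqxx.
  have D'D i : (i < k)%N -> D' i = D i by move=> ik; rewrite /D' ltn_eqF.
  rewrite noise_cylinder_prod//.
  have := noise_cylinder_prod k.+1 mD'.
  rewrite big_ord_recr /= D'k (eq_bigr (fun i : 'I_k => P (w i @^-1` D i))); last first.
    by move=> i _; rewrite D'D.
  move=> <-; congr (P _); apply/seteqP; split.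
    move=> t [/= Dt Ct] i /=; rewrite ltnS leq_eqVlt => /orP[/eqP ->|ik].
      by rewrite D'k.
    by rewrite D'D//; exact: Dt.
  move=> t Dt; split => [i /= ik|]; last by have := Dt k (ltnSn k); rewrite D'k.
  by have := Dt i (ltnW ik); rewrite D'D.
Qed.

End past_of_noise.

(** * Integration with one of two independent arguments frozen *)

Section freezing.
Context d (T : measurableType d) (R : realType) (P : probability T R).
Context dA (A : measurableType dA) dB (B : measurableType dB).

(** Factorization on rectangles identifies the law of (X, Y) with the product of the marginal laws.
    Tonelli then splits the integral, and a change of variables in each factor brings it back to the
    sample space. *)
Lemma integral_independent_pair (X : T -> A) (Y : T -> B) (h : A * B -> \bar R) :
  measurable_fun setT X -> measurable_fun setT Y ->
  (forall U V, measurable U -> measurable V ->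
    P (X @^-1` U `&` Y @^-1` V) = P (X @^-1` U) * P (Y @^-1` V))%E ->
  measurable_fun setT h -> (forall p, 0 <= h p)%E ->
  (\int[P]_t h (X t, Y t) = \int[P]_t \int[P]_s h (X t, Y s))%E.
Proof.
move=> mX mY indXY mh h0.
pose X' : {RV P >-> A} := HB.pack X (isMeasurableFun.Build _ _ _ _ X mX).
pose Y' : {RV P >-> B} := HB.pack Y (isMeasurableFun.Build _ _ _ _ Y mY).
pose Z t := (X t, Y t).
have mZ : measurable_fun setT Z by exact: measurable_fun_pair.
pose Z' : {RV P >-> (A * B)%type} := HB.pack Z (isMeasurableFun.Build _ _ _ _ Z mZ).
transitivity (\int[distribution P Z']_p h p)%E.
  by rewrite ge0_integral_pushforward.
transitivity (\int[(distribution P X' \x distribution P Y')%E]_p h p)%E.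
  apply: eq_measure_integral => S mS _; apply/esym.
  by apply: product_measure_unique => // U V mU mV; rewrite -indXY.
rewrite fubini_tonelli1// ge0_integral_pushforward//; last 2 first.
  exact: measurable_fun_fubini_tonelli_F.
  by move=> x _; exact: integral_ge0.
apply: eq_integral => t _; rewrite /= /fubini_F ge0_integral_pushforward//.
exact: measurableT_comp.
Qed.

End freezing.

(** * The energy inequality along trajectories *)

Section energy.
Context d (T : measurableType d) (R : realType) (P : probability T R) (N nw nv : nat).
Variable w : nat -> T -> 'cV[R]_nw.
Hypothesis hw : forall k, random_vector (w k).
Hypothesis hindep : independent_vectors P w.
Variable F : 'cV[R]_N -> 'cV[R]_nw -> 'cV[R]_nv -> 'cV[R]_N.
Hypothesis mF : @measurable_fun _ _
  (borel_cV R N * borel_cV R nw * borel_cV R nv)%type (borel_cV R N) setT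
  (fun p => F p.1.1 p.1.2 p.2).
Variable v : nat -> T -> 'cV[R]_nv.
Hypothesis hv : adapted (noise_filtration w) v.
Variable eta0 : 'cV[R]_N.

Let eta := trajectory F w v eta0.

Lemma adapted_measurable k :
  @measurable_fun _ _ (noise_space w k) (borel_cV R nv) setT (v k).
Proof. by move=> _ B mB; rewrite setTI; exact: hv. Qed.

Lemma measurable_noise_space d' (U : measurableType d') k (X : T -> U) :
  @measurable_fun _ _ (noise_space w k) U setT X -> measurable_fun setT X.
Proof.
move=> mX _ B mB; apply: (noise_filtration_measurable hw (k := k)).
exact: (mX measurableT).
Qed.

Lemma measurable_noise_spaceS d' (U : measurableType d') k (X : T -> U) :
  @measurable_fun _ _ (noise_space w k) U setT X ->
  @measurable_fun _ _ (noise_space w k.+1) U setT X.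
Proof.
move=> mX _ B mB; apply: (noise_filtration_mono (leqnSn k)).
exact: (mX measurableT).
Qed.

Lemma trajectory_adapted k :
  @measurable_fun _ _ (noise_space w k) (borel_cV R N) setT (eta k).
Proof.
elim: k => [|k IH]; first exact: measurable_cst.
have mX : @measurable_fun _ _ (noise_space w k.+1)
    (borel_cV R N * borel_cV R nw * borel_cV R nv)%type setT
    (fun t => (eta k t, w k t, v k t)).
  apply: measurable_fun_pair; last first.
    exact: (measurable_noise_spaceS (@adapted_measurable k)).
  apply: measurable_fun_pair; first exact: (measurable_noise_spaceS IH).
  (* [w k] is not known at time [k] but is one of the generators of F_(k+1). *)
  move=> _ B mB; apply: sub_sigma_algebra; exists k => //=.
  by exists B.
exact: (measurableT_comp mF mX).
Qed.

Lemma measurable_trajectory k :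
  @measurable_fun _ _ T (borel_cV R N) setT (eta k).
Proof. exact: (measurable_noise_space (@trajectory_adapted k)). Qed.

Lemma measurable_disturbance k : @measurable_fun _ _ T (borel_cV R nv) setT (v k).
Proof. exact: (measurable_noise_space (@adapted_measurable k)). Qed.

Variables (V : 'cV[R]_N -> R) (a : 'cV[R]_N -> 'cV[R]_nv -> R) (b : 'cV[R]_nv -> R).
Hypothesis mV : @measurable_fun _ _ (borel_cV R N) R setT V.
Hypothesis ma : @measurable_fun _ _ (borel_cV R N * borel_cV R nv)%type R setT
  (fun p => a p.1 p.2).
Hypothesis mb : @measurable_fun _ _ (borel_cV R nv) R setT b.
Hypothesis V0 : forall x, 0 <= V x.
Hypothesis a0 : forall x u, 0 <= a x u.
Hypothesis b0 : forall u, 0 <= b u.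
Hypothesis dissip : forall x u k,
  (\int[P]_t (V (F x (w k t) u))%:E + (a x u)%:E <= (V x)%:E + (b u)%:E)%E.

Lemma energy_step k :
  (\int[P]_t (V (eta k.+1 t))%:E + \int[P]_t (a (eta k t) (v k t))%:E <=
   \int[P]_t (V (eta k t))%:E + \int[P]_t (b (v k t))%:E)%E.
Proof.
pose X t := (eta k t, v k t).
have mX : @measurable_fun _ _ (noise_space w k) (borel_cV R N * borel_cV R nv)%type setT X.
  exact: (measurable_fun_pair (@trajectory_adapted k) (@adapted_measurable k)).
have mX' := measurable_noise_space mX.
(* The arguments are regrouped as (past, noise), the form required by
   [integral_independent_pair]. *)
pose h (p : borel_cV R N * borel_cV R nv * borel_cV R nw) : \bar R :=
  (V (F p.1.1 p.2 p.1.2))%:E.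
have mh : measurable_fun setT h.
  apply/measurable_EFinP; apply: (measurableT_comp mV).
  apply: (measurableT_comp mF (g := fun p => (p.1.1, p.2, p.1.2))).
  apply: measurable_fun_pair.
    apply: measurable_fun_pair; last exact: measurable_snd.
    exact: (measurableT_comp measurable_fst measurable_fst).
  exact: (measurableT_comp measurable_snd measurable_fst).
have h0 p : (0 <= h p)%E by rewrite lee_fin.
have past_indep (A : set (borel_cV R N * borel_cV R nv)) (B : set (borel_cV R nw)) :
    measurable A -> measurable B ->
    (P (X @^-1` A `&` w k @^-1` B) = P (X @^-1` A) * P (w k @^-1` B))%E.
  move=> mA mB; apply: noise_independent_past => //.
  by have := mX measurableT _ mA; rewrite setTI.
have -> : (\int[P]_t (V (eta k.+1 t))%:E = \int[P]_t \int[P]_s h (X t, w k s))%E.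
  exact: (integral_independent_pair mX' (hw k) past_indep mh h0).
have mG : measurable_fun setT (fun t => \int[P]_s h (X t, w k s))%E.
  (* With the noise variable pulled back to [T], Tonelli gives measurability of the inner integral
     with respect to [P] itself. *)
  pose h' (p : borel_cV R N * borel_cV R nv * T) := h (p.1, w k p.2).
  have mh' : measurable_fun setT h'.
    have mp : @measurable_fun _ _ (borel_cV R N * borel_cV R nv * T)%type
        (borel_cV R N * borel_cV R nv * borel_cV R nw)%type setT
        (fun p => (p.1, w k p.2)).
      apply: measurable_fun_pair; first exact: measurable_fst.
      exact: (measurableT_comp (hw k) measurable_snd).
    exact: (measurableT_comp mh mp).
  have h'0 p : (0 <= h' p)%E by exact: h0.
  exact: (measurableT_comp (measurable_fun_fubini_tonelli_F (m2 := P) h' mh' h'0) mX').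
have mVk : measurable_fun setT (fun t => (V (eta k t))%:E).
  by apply/measurable_EFinP; exact: (measurableT_comp mV (@measurable_trajectory k)).
have mak : measurable_fun setT (fun t => (a (eta k t) (v k t))%:E).
  by apply/measurable_EFinP; exact: (measurableT_comp ma mX').
have mbk : measurable_fun setT (fun t => (b (v k t))%:E).
  by apply/measurable_EFinP; exact: (measurableT_comp mb (@measurable_disturbance k)).
have G0 t : (0 <= \int[P]_s h (X t, w k s))%E by apply: integral_ge0 => s _.
(* Nonnegativity allows the integrals to be merged even when infinite; what remains is [dissip] at
   the point (eta k t, v k t). *)
rewrite -!ge0_integralD//; do ?by move=> *; rewrite lee_fin.
apply: ge0_le_integral => //; try exact: emeasurable_funD.
- by move=> t _; rewrite adde_ge0// lee_fin.
- by move=> t _; exact: dissip.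
Qed.

(** [F], [a] and [b] are kept abstract because this is used twice: for the system itself with output
    energy and supply, and with a = b = 0 for the dynamics frozen at a level of [V]. *)
Lemma energy_inequality K :
  (\int[P]_t (V (eta K t))%:E + \sum_(0 <= k < K) \int[P]_t (a (eta k t) (v k t))%:E <=
   (V eta0)%:E + \sum_(0 <= k < K) \int[P]_t (b (v k t))%:E)%E.
Proof.
elim: K => [|K IH].
  rewrite !big_geq// !adde0.
  by rewrite -[leRHS]mule1 -(probability_setT P) -integral_cst.
rewrite !big_nat_recr//= [X in (_ + X <= _)%E]addeC [leLHS]addeA.
by rewrite (le_trans (leeD2r _ (energy_step K)))// addeAC [leRHS]addeA leeD2r.
Qed.

End energy.

(** * Dissipative systems: external stability *)

Section dissipative_system.
Context d (T : measurableType d) (R : realType) (P : probability T R) (N nw nv nz : nat).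
Variable w : nat -> T -> 'cV[R]_nw.
Hypothesis hw : forall k, random_vector (w k).
Hypothesis hindep : independent_vectors P w.
Variable F : 'cV[R]_N -> 'cV[R]_nw -> 'cV[R]_nv -> 'cV[R]_N.
Hypothesis mF : @measurable_fun _ _
  (borel_cV R N * borel_cV R nw * borel_cV R nv)%type (borel_cV R N) setT
  (fun p => F p.1.1 p.1.2 p.2).
Variable M : 'cV[R]_N -> 'cV[R]_nv -> 'cV[R]_nz.
Hypothesis mM : @measurable_fun _ _
  (borel_cV R N * borel_cV R nv)%type (borel_cV R nz) setT (fun p => M p.1 p.2).
Variables (V W : 'cV[R]_N -> R) (gamma : R).
Hypothesis hV : positive_radially_unbounded V.
Hypothesis hW : positive_radially_unbounded W.
Hypothesis dissip : forall x u k,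
  (\int[P]_t (V (F x (w k t) u))%:E + (enorm (M x u) ^+ 2)%:E <=
   (V x)%:E + (gamma ^+ 2 * enorm u ^+ 2)%:E)%E.
Hypothesis hobs : forall x, W x <= enorm (M x 0) ^+ 2.

Lemma positive_radially_unbounded_ge0 (U : 'cV[R]_N -> R) x :
  positive_radially_unbounded U -> 0 <= U x.
Proof. by move=> [_ U0 Upos _]; have [->|/Upos/ltW//] := eqVneq x 0; rewrite U0. Qed.

Let V0 x : 0 <= V x. Proof. exact: positive_radially_unbounded_ge0. Qed.

Let mV : @measurable_fun _ _ (borel_cV R N) R setT V.
Proof. by apply: continuous_measurable_realfun; case: hV. Qed.

Lemma measurable_enorm_sqr n :
  @measurable_fun _ _ (borel_cV R n) R setT (fun x => enorm x ^+ 2).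
Proof.
apply: continuous_measurable_realfun => x.
apply: (@continuous_comp _ _ _ (@enorm R n) (fun r => r ^+ 2)).
  exact: enorm_continuous.
exact: exprn_continuous.
Qed.

Let a x u := enorm (M x u) ^+ 2.
Let b (u : 'cV[R]_nv) := gamma ^+ 2 * enorm u ^+ 2.

Let ma : @measurable_fun _ _ (borel_cV R N * borel_cV R nv)%type R setT
  (fun p => a p.1 p.2).
Proof. exact: (measurableT_comp (measurable_enorm_sqr (n := nz)) mM). Qed.

Let mb : @measurable_fun _ _ (borel_cV R nv) R setT b.
Proof. by apply: measurable_funM => //; exact: measurable_enorm_sqr. Qed.

Let a0 x u : 0 <= a x u. Proof. exact: sqr_ge0. Qed.
Let b0 u : 0 <= b u. Proof. by rewrite mulr_ge0// sqr_ge0. Qed.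

Lemma supply_inequality v eta0 K : adapted (noise_filtration w) v ->
  (\sum_(0 <= k < K) \int[P]_t (enorm (M (trajectory F w v eta0 k t) (v k t)) ^+ 2)%:E <=
   (V eta0)%:E + \sum_(0 <= k < K) \int[P]_t (gamma ^+ 2 * enorm (v k t) ^+ 2)%:E)%E.
Proof.
move=> hv.
apply: le_trans (energy_inequality hw hindep mF hv eta0 mV ma mb V0 a0 b0 dissip K).
by rewrite leeDr// integral_ge0// => t _; rewrite lee_fin.
Qed.

Lemma dissipative_externally_stable : externally_stable P F M w gamma.
Proof.
move=> v [hv _] _; rewrite /l2_norm_sq.
have mv := measurable_disturbance hw hv.
have mx := measurable_trajectory hw mF hv 0.
have mak k : measurable_fun setT
    (fun t => (enorm (M (trajectory F w v 0 k t) (v k t)) ^+ 2)%:E).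
  apply/measurable_EFinP.
  exact: (measurableT_comp ma (measurable_fun_pair (mx k) (mv k))).
have mvk k : measurable_fun setT (fun t => (enorm (v k t) ^+ 2)%:E).
  apply/measurable_EFinP; exact: (measurableT_comp (measurable_enorm_sqr (n := nv)) (mv k)).
rewrite integral_nneseries//; last by move=> k t _; rewrite lee_fin sqr_ge0.
rewrite integral_nneseries//; last by move=> k t _; rewrite lee_fin sqr_ge0.
have Iv0 k : (0 <= \int[P]_t (enorm (v k t) ^+ 2)%:E)%E.
  by apply: integral_ge0 => t _; rewrite lee_fin sqr_ge0.
apply: lime_le.
  by apply: is_cvg_nneseries => k _ _; apply: integral_ge0 => t _; rewrite lee_fin sqr_ge0.
apply: nearW => K; apply: (le_trans (supply_inequality 0 K hv)).
have -> : V 0 = 0 by case: hV.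
rewrite add0e -nneseriesZl//.
rewrite (eq_bigr (fun k => (gamma ^+ 2)%:E * \int[P]_t (enorm (v k t) ^+ 2)%:E)%E).
  by apply: nneseries_lim_ge => k _ _; rewrite mule_ge0// lee_fin sqr_ge0.
move=> k _; rewrite -ge0_integralZl_EFin ?sqr_ge0//.
by move=> t _; rewrite lee_fin sqr_ge0.
Qed.

(** * Dissipative systems: internal stability without disturbance *)

Let v0 : nat -> T -> 'cV[R]_nv := fun _ _ => 0.

Let hv0 : adapted (noise_filtration w) v0.
Proof.
move=> k B mB.
have := @measurable_cst _ _ (noise_space w k) (borel_cV R nv) setT 0.
by move=> /(_ measurableT _ mB); rewrite setTI.
Qed.

Let eta := trajectory F w v0.

Let meta eta0 k : @measurable_fun _ _ T (borel_cV R N) setT (eta eta0 k).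
Proof. exact: measurable_trajectory. Qed.

(* The dynamics frozen once V reaches c: it inherits the dissipation
   inequality, so Markov's inequality for V along its trajectories is the maximal
   inequality for V along the original ones. *)
Let stopped (c : R) x q (u : 'cV[R]_nv) := if V x < c then F x q 0 else x.

Let stopped_eta c eta0 := trajectory (stopped c) w v0 eta0.

Let stopped_etaS c eta0 k t : stopped_eta c eta0 k.+1 t =
  if V (stopped_eta c eta0 k t) < c then F (stopped_eta c eta0 k t) (w k t) 0
  else stopped_eta c eta0 k t.
Proof. by []. Qed.

Lemma stopped_reaches (c : R) eta0 k t j : (j <= k)%N ->
  c <= V (eta eta0 j t) -> c <= V (stopped_eta c eta0 k t).
Proof.
move=> jk.
have inv : (stopped_eta c eta0 k t = eta eta0 k t /\
    forall i, (i < k)%N -> V (eta eta0 i t) < c) \/ c <= V (stopped_eta c eta0 k t).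
  elim: k {jk} => [|k [[eqk ltc]|gec]]; first by left.
    have [Vc|Vc] := ltP (V (eta eta0 k t)) c.
      left; split; first by rewrite stopped_etaS eqk Vc.
      by move=> i; rewrite ltnS leq_eqVlt => /orP[/eqP -> //|]; exact: ltc.
    by right; rewrite stopped_etaS eqk ltNge Vc.
  by right; rewrite stopped_etaS ltNge gec.
move: jk; case: inv => [[eqk ltc]|//]; rewrite leq_eqVlt.
move=> /orP[/eqP ->|jk]; first by rewrite eqk.
by rewrite leNgt ltc.
Qed.

Lemma measurable_stopped c : @measurable_fun _ _
  (borel_cV R N * borel_cV R nw * borel_cV R nv)%type (borel_cV R N) setT
  (fun p => stopped c p.1.1 p.1.2 p.2).
Proof.
have mx : @measurable_fun _ _ (borel_cV R N * borel_cV R nw * borel_cV R nv)%type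
    (borel_cV R N) setT (fun p => p.1.1).
  exact: (measurableT_comp measurable_fst measurable_fst).
apply: measurable_fun_ifT => //.
  by apply: measurable_fun_ltr => //; exact: (measurableT_comp mV mx).
have mp : @measurable_fun _ _ (borel_cV R N * borel_cV R nw * borel_cV R nv)%type
    (borel_cV R N * borel_cV R nw * borel_cV R nv)%type setT (fun p => (p.1.1, p.1.2, 0)).
  apply: measurable_fun_pair; last exact: measurable_cst.
  apply: measurable_fun_pair => //.
  exact: (measurableT_comp measurable_snd measurable_fst).
exact: (measurableT_comp mF mp).
Qed.

Lemma maximal_inequality (c : R) eta0 : 0 < c ->
  (P (\bigcup_k [set t | (c <= V (eta eta0 k t))%R]) <= (V eta0 / c)%:E)%E.
Proof.
move=> c0; pose S k := [set t | c <= V (stopped_eta c eta0 k t)].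
have mVs k : measurable_fun setT (fun t => V (stopped_eta c eta0 k t)).
  exact: (measurableT_comp mV (measurable_trajectory hw (measurable_stopped c) hv0 eta0 k)).
have mS k : measurable (S k).
  have := measurable_fun_ler (@measurable_cst _ _ T R setT c) (mVs k).
  by move=> /(_ measurableT [set true] I); rewrite setTI.
have ES k : (\int[P]_t (V (stopped_eta c eta0 k t))%:E <= (V eta0)%:E)%E.
  (* Below level [c] this is [dissip] at zero disturbance with the output term dropped; from [c] on,
     the state is constant and equality holds. *)
  have dissipS x u l :
      (\int[P]_t (V (stopped c x (w l t) u))%:E + 0%:E <= (V x)%:E + 0%:E)%E.
    rewrite !adde0 /stopped; case: (V x < c).
      apply: (@le_trans _ _
        (\int[P]_t (V (F x (w l t) 0))%:E + (enorm (M x 0) ^+ 2)%:E)%E).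
        by rewrite leeDl// lee_fin sqr_ge0.
      by rewrite (le_trans (dissip x 0 l))// enorm0 expr0n mulr0 adde0.
    by rewrite -[leRHS]mule1 -(probability_setT P) -integral_cst.
  have := energy_inequality (a := fun _ _ => 0) (b := fun=> 0) hw hindep
    (measurable_stopped c) hv0 eta0 mV (measurable_cst _) (measurable_cst _)
    V0 (fun _ _ => lexx _) (fun _ => lexx _) dissipS k.
  rewrite !big1 ?adde0// => i _; exact: integral0.
have PS k : (P (S k) <= (V eta0 / c)%:E)%E.
  rewrite EFinM lee_pdivlMr// muleC -integral_cst//.
  apply: le_trans (ES k).
  apply: (@le_trans _ _ (\int[P]_(t in S k) (V (stopped_eta c eta0 k t))%:E)%E).
    apply: ge0_le_integral => //; try exact/measurable_funTS/measurable_EFinP.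
    by move=> t _; rewrite lee_fin ltW.
  apply: ge0_subset_integral => //; first exact/measurable_EFinP.
  by move=> t _; rewrite lee_fin.
have mE k : measurable [set t | c <= V (eta eta0 k t)].
  have := measurable_fun_ler (@measurable_cst _ _ T R setT c)
    (measurableT_comp mV (meta eta0 k)).
  by move=> /(_ measurableT [set true] I); rewrite setTI.
apply: (@le_trans _ _ (P (\bigcup_k S k))).
  apply: le_measure; rewrite ?inE; [exact: bigcupT_measurable|exact: bigcupT_measurable|].
  by apply: subset_bigcup => k _ t /=; exact: stopped_reaches.
have ndS : {homo S : n m / (n <= m)%N >-> (n <= m)%O}.
  apply/nondecreasing_seqP => k; apply/subsetPset => t /= St.
  by rewrite /S /= stopped_etaS ltNge St.
have cvS := nondecreasing_cvg_mu (mu := P) mS (bigcupT_measurable _ mS) ndS.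
rewrite -(cvg_lim _ cvS)//; apply: lime_le; first by apply/cvg_ex; eexists; exact: cvS.
by apply: nearW => k; exact: PS.
Qed.

Lemma overshoot_probability (eps : R) : 0 < eps ->
  P [set t | (eps%:E < ereal_sup (range (fun k => (enorm (eta eta0 k t))%:E)))%E]
    @[eta0 --> (0 : 'cV[R]_N)^'] --> 0%E.
Proof.
move=> e0; have [c c0 Vc] := positive_radially_unbounded_lower_bound hV e0.
(* Leaving the ball of radius [eps] forces V >= c, so the probability is at most V(eta0)/c, which
   vanishes at 0 by continuity of [V]. *)
apply: (@squeeze_cvge _ _ _ _ (fun=> 0%E) _ (fun x => (V x / c)%:E)).
- apply: nearW => eta0; rewrite measure_ge0 /=.
  apply: le_trans (maximal_inequality eta0 c0).
  have -> : [set t | (eps%:E < ereal_sup (range (fun k => (enorm (eta eta0 k t))%:E)))%E] =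
      \bigcup_k [set t | eps < enorm (eta eta0 k t)].
    apply/seteqP; split => [t /= /ereal_sup_gt[_ [k _ <-]]|t [k _ /= et]].
      by rewrite lte_fin => et; exists k.
    apply: (@lt_le_trans _ _ (enorm (eta eta0 k t))%:E); first by rewrite lte_fin.
    by apply: ereal_sup_ubound; exists k.
  have mn k : measurable_fun setT (fun t => enorm (eta eta0 k t)).
    apply: (measurableT_comp _ (meta eta0 k)).
    by apply: continuous_measurable_realfun; exact: enorm_continuous.
  apply: le_measure; rewrite ?inE.
  + apply: bigcupT_measurable => k.
    have := measurable_fun_ltr (@measurable_cst _ _ T R setT eps) (mn k).
    by move=> /(_ measurableT [set true] I); rewrite setTI.
  + apply: bigcupT_measurable => k.
    have := measurable_fun_ler (@measurable_cst _ _ T R setT c)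
      (measurableT_comp mV (meta eta0 k)).
    by move=> /(_ measurableT [set true] I); rewrite setTI.
  + by apply: subset_bigcup => k _ t /= /ltW; exact: Vc.
- exact: cvg_cst.
- apply: cvg_EFin; first exact: nearW.
  have [cV V00 _ _] := hV.
  have : V x / c @[x --> (0 : 'cV[R]_N)] --> V 0 / c.
    exact: (cvgM (cV 0) (cvg_cst _)).
  rewrite V00 mul0r => cVc.
  exact: cvg_trans (cvg_app _ (@cvg_within _ _ _ _)) cVc.
Qed.

Hypothesis hP : measure_is_complete P.

Lemma trajectory_cvg0 eta0 :
  P [set t | eta eta0 k t @[k --> \oo] --> (0 : 'cV[R]_N)] = 1%E.
Proof.
(* Output energies are summed, since the supply inequality bounds them directly; [W] enters only
   afterwards, path by path. *)
pose s k t := (a (eta eta0 k t) 0)%:E.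
have ms k : measurable_fun setT (s k).
  apply/measurable_EFinP.
  have mp : @measurable_fun _ _ T (borel_cV R N * borel_cV R nv)%type setT
      (fun t => (eta eta0 k t, 0)).
    by apply: measurable_fun_pair => //; exact: measurable_cst.
  exact: (measurableT_comp ma mp).
have s0 k t : (0 <= s k t)%E by rewrite lee_fin.
have mSs : measurable_fun setT (fun t => \sum_(0 <= k <oo) s k t)%E.
  exact: (ge0_emeasurable_sum (P := xpredT)).
have intS : P.-integrable setT (fun t => \sum_(0 <= k <oo) s k t)%E.
  apply/integrableP; split => //.
  apply: (@le_lt_trans _ _ (V eta0)%:E); last exact: ltry.
  under eq_integral do rewrite gee0_abs ?nneseries_ge0//.
  rewrite integral_nneseries//; apply: lime_le.
    by apply: is_cvg_nneseries => k _ _; exact: integral_ge0.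
  apply: nearW => K; apply: (le_trans (supply_inequality eta0 K hv0)).
  rewrite [X in (_ + X)%E]big1 ?adde0// => k _.
  by rewrite integral0_eq// => t _; rewrite enorm0 expr0n mulr0.
have sub : [set t | (\sum_(0 <= k <oo) s k t)%E \is a fin_num] `<=`
    [set t | eta eta0 k t @[k --> \oo] --> (0 : 'cV[R]_N)].
  move=> t /= fint; apply: cvg_enorm0; apply/cvgrPdist_lt => e e0.
  have [c c0 Wc] := positive_radially_unbounded_lower_bound hW e0.
  have := @nneseries_tail_cvg R (s ^~ t) xpredT.
  rewrite ltey_eq fint => /(_ isT (fun k _ => s0 k t)) tail.
  have : \forall n \near \oo, (\sum_(n <= k <oo) s k t < c%:E)%E.
    have /fine_cvgP[finS] := tail.
    move=> /cvgrPdist_lt /(_ c c0) /(filterI finS); apply: filterS => n [fn].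
    by rewrite sub0r normrN => /(le_lt_trans (ler_norm _)); rewrite -lte_fin fineK.
  (* If the state had norm at least [e] at time [n], then W >= c there, so the [n]-th output energy
     alone would exceed the tail starting at [n]. *)
  apply: filterS => n lt_tail; rewrite sub0r normrN ger0_norm ?enorm_ge0// ltNge.
  apply: contraTN (lt_tail) => /Wc; rewrite -leNgt => cW.
  apply: (@le_trans _ _ (s n t)); first by rewrite lee_fin (le_trans cW).
  have := @nneseries_lim_ge R (s ^~ t) xpredT n n.+1 (fun k _ _ => s0 k t).
  by rewrite big_nat1.
(* The convergence event is only known to contain an almost sure event; completeness of [P] makes
   its negligible complement measurable. *)
have [Z [mZ PZ sZ]] :
    P.-negligible (~` [set t | eta eta0 k t @[k --> \oo] --> (0 : 'cV[R]_N)]).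
  have := integrable_ae measurableT intS; apply: negligibleS => t /= nt /(_ I) fint.
  exact: nt (sub _ fint).
set C := [set t | _].
have mC : measurable (~` C) by apply: hP; exists Z.
rewrite -[C]setCK probability_setC//.
have -> : P (~` C) = 0%E by apply/eqP; rewrite -measure_le0 -PZ le_measure ?inE.
by rewrite sube0.
Qed.

Lemma dissipative_internally_stable : internally_stable P F w.
Proof. by split; [exact: overshoot_probability|exact: trajectory_cvg0]. Qed.

End dissipative_system.

(** * Measurability of the augmented system, and the conclusion *)

Lemma measurable_aug_dynamics (R : realType) (n nw nv ny nh : nat)
    (f : 'cV[R]_n * 'cV[R]_nw * 'cV[R]_nv -> 'cV[R]_n)
    (g : 'cV[R]_n * 'cV[R]_nv -> 'cV[R]_ny)
    (fh : 'cV[R]_nh -> 'cV[R]_nh) (gh : 'cV[R]_ny -> 'cV[R]_nh) :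
  continuous f -> continuous g -> borel_measurable fh -> borel_measurable gh ->
  @measurable_fun _ _ (borel_cV R (n + nh) * borel_cV R nw * borel_cV R nv)%type
    (borel_cV R (n + nh)) setT (fun p => aug_dynamics f g fh gh p.1.1 p.1.2 p.2).
Proof.
move=> cf cg mfh mgh.
pose D : measurableType _ := (borel_cV R (n + nh) * borel_cV R nw * borel_cV R nv)%type.
have meta : @measurable_fun _ _ D (borel_cV R (n + nh)) setT (fun p => p.1.1).
  exact: (measurableT_comp measurable_fst measurable_fst).
have mw : @measurable_fun _ _ D (borel_cV R nw) setT (fun p => p.1.2).
  exact: (measurableT_comp measurable_snd measurable_fst).
have mv : @measurable_fun _ _ D (borel_cV R nv) setT (fun p => p.2).
  exact: measurable_snd.
have mx : @measurable_fun _ _ D (borel_cV R n) setT (fun p => usubmx p.1.1).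
  exact: (measurableT_comp (continuous_measurable_borel (@usubmx_continuous _ _ _ _)) meta).
have mxh : @measurable_fun _ _ D (borel_cV R nh) setT (fun p => dsubmx p.1.1).
  exact: (measurableT_comp (continuous_measurable_borel (@dsubmx_continuous _ _ _ _)) meta).
have cbV k := @countably_based_matrix R k 1.
have my : @measurable_fun _ _ D (borel_cV R ny) setT (fun p => g (usubmx p.1.1, p.2)).
  exact: (measurable_continuous_pair (cbV _) (cbV _) cg mx mv).
have mf : @measurable_fun _ _ D (borel_cV R n) setT
    (fun p => f (usubmx p.1.1, p.1.2, p.2)).
  have /measurable_fun_borelP mx' := mx; have /measurable_fun_borelP mw' := mw.
  have /measurable_fun_borelP mv' := mv.
  (* The domain of [f] is a nested product, so pairing is done twice at the level of open preimages
     before a Borel structure is chosen. *)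
  apply/measurable_fun_borelP; apply: (open_preimage_measurable_comp cf).
  apply: (open_preimage_measurable_pair _ _ _ mv') => //.
    exact: countably_based_prod (cbV _) (cbV _).
    exact: cbV.
  exact: open_preimage_measurable_pair (cbV _) (cbV _) mx' mw'.
have mfg : @measurable_fun _ _ D (borel_cV R nh) setT
    (fun p => fh (dsubmx p.1.1) + gh (g (usubmx p.1.1, p.2))).
  have mfx : @measurable_fun _ _ D (borel_cV R nh) setT (fun p => fh (dsubmx p.1.1)).
    exact: (measurableT_comp mfh mxh).
  have mgy : @measurable_fun _ _ D (borel_cV R nh) setT
      (fun p => gh (g (usubmx p.1.1, p.2))).
    exact: (measurableT_comp mgh my).
  have cD : continuous (fun p : 'cV[R]_nh * 'cV[R]_nh => p.1 + p.2).
    exact: add_continuous.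
  exact: (measurable_continuous_pair (cbV _) (cbV _) cD mfx mgy).
exact: (measurable_continuous_pair (cbV _) (cbV _) (@col_mx_continuous _ _ _ _) mf mfg).
Qed.

Lemma measurable_aug_output (R : realType) (n nv nz nh : nat)
    (m : 'cV[R]_n * 'cV[R]_nv -> 'cV[R]_nz) (mh : 'cV[R]_nh -> 'cV[R]_nz) :
  continuous m -> borel_measurable mh ->
  @measurable_fun _ _ (borel_cV R (n + nh) * borel_cV R nv)%type (borel_cV R nz) setT
    (fun p => aug_output m mh p.1 p.2).
Proof.
move=> cm mmh.
pose D : measurableType _ := (borel_cV R (n + nh) * borel_cV R nv)%type.
have mx : @measurable_fun _ _ D (borel_cV R n) setT (fun p => usubmx p.1).
  exact: (measurableT_comp (continuous_measurable_borel (@usubmx_continuous _ _ _ _))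
    measurable_fst).
have mxh : @measurable_fun _ _ D (borel_cV R nh) setT (fun p => dsubmx p.1).
  exact: (measurableT_comp (continuous_measurable_borel (@dsubmx_continuous _ _ _ _))
    measurable_fst).
have cbV k := @countably_based_matrix R k 1.
have mz : @measurable_fun _ _ D (borel_cV R nz) setT (fun p => m (usubmx p.1, p.2)).
  exact: (measurable_continuous_pair (cbV _) (cbV _) cm mx measurable_snd).
have cB : continuous (fun p : 'cV[R]_nz * 'cV[R]_nz => p.1 - p.2).
  exact: sub_continuous.
have mzh : @measurable_fun _ _ D (borel_cV R nz) setT (fun p => mh (dsubmx p.1)).
  exact: (measurableT_comp mmh mxh).
exact: (measurable_continuous_pair (cbV _) (cbV _) cB mz mzh).
Qed.

(** Here [x] is the expectation of [V] after one step, a priori infinite; the value +oo contradicts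
    the hypothesis. *)
Lemma lee_of_balance (R : realType) (x : \bar R) (v a b : R) :
  (x - v%:E + a%:E - b%:E <= 0)%E -> (x + a%:E <= v%:E + b%:E)%E.
Proof.
case: x => [r| |] /=.
- by rewrite !lee_fin subr_le0 addrAC lerBlDl.
- by rewrite !addye// leye_eq.
- by rewrite !addNye !leNye.
Qed.

Theorem corollary1 (R : realType) (d : measure_display) (T : measurableType d)
    (P : probability T R) (hP : measure_is_complete P)
    (n nw nv ny nz nh : nat)
    (w : nat -> T -> 'cV[R]_nw)
    (hw : forall k, random_vector (w k))
    (hindep : independent_vectors P w)
    (f : 'cV[R]_n * 'cV[R]_nw * 'cV[R]_nv -> 'cV[R]_n)
    (g : 'cV[R]_n * 'cV[R]_nv -> 'cV[R]_ny)
    (m : 'cV[R]_n * 'cV[R]_nv -> 'cV[R]_nz)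
    (hf : continuous f) (hf0 : f (0, 0, 0) = 0)
    (hg : continuous g) (hg0 : g (0, 0) = 0)
    (hm : continuous m) (hm0 : m (0, 0) = 0)
    (fh : 'cV[R]_nh -> 'cV[R]_nh) (gh : 'cV[R]_ny -> 'cV[R]_nh)
    (mh : 'cV[R]_nh -> 'cV[R]_nz)
    (hfh : borel_measurable fh) (hfh0 : fh 0 = 0)
    (hgh : borel_measurable gh) (hgh0 : gh 0 = 0)
    (hmh : borel_measurable mh) (hmh0 : mh 0 = 0)
    (gamma : R) (hgamma : 0 < gamma)
    (V W : 'cV[R]_(n + nh) -> R)
    (hV : positive_radially_unbounded V)
    (hW : positive_radially_unbounded W)
    (hdissip : forall (eta : 'cV[R]_(n + nh)) (v : 'cV[R]_nv) (k : nat),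
       ('E_P[fun t => V (aug_dynamics f g fh gh eta (w k t) v)]
          - (V eta)%:E + (enorm (aug_output m mh eta v) ^+ 2)%:E
          - (gamma ^+ 2 * enorm v ^+ 2)%:E <= 0)%E)
    (hobs : forall eta : 'cV[R]_(n + nh),
       W eta <= enorm (aug_output m mh eta 0) ^+ 2) :
  Hinfty_filter P w f g m fh gh mh gamma.
Proof.
have mF := measurable_aug_dynamics hf hg hfh hgh.
have mM := measurable_aug_output hm hmh.
have dissip x u k : (\int[P]_t (V (aug_dynamics f g fh gh x (w k t) u))%:E +
    (enorm (aug_output m mh x u) ^+ 2)%:E <=
    (V x)%:E + (gamma ^+ 2 * enorm u ^+ 2)%:E)%E.
  by apply: lee_of_balance; have := hdissip x u k; rewrite unlock.
split.
  exact: (dissipative_internally_stable hw hindep mF mM hV hW dissip hobs hP).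
exact: (dissipative_externally_stable hw hindep mF mM hV dissip).
Qed.
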